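(* Let $H=\prod_p p^{a_p}<H'=\prod_p p^{b_p}$ be consecutive highly composite numbers. Suppose exactly one source support prime disappears: for some prime $r$ one has $a_r=1$, $b_r=0$, and no prime $p\ne r$ satisfies $a_p>0=b_p$. Delete the layer $(r,1)$ first. List all remaining required deletion layers as $D_i=(p_i,A_i)$, $1\le i\le k$ (where $D_i$ lowers the exponent of $p_i$ from $A_i$ to $A_i-1$), in a stack-admissible order, i.e. if $p_i=p_h$ and $i<h$ then $A_i>A_h$. Match them injectively to distinct required insertion layers $I_i=(q_i,j_i)$, $1\le i\le k$ (where $I_i$ raises the exponent of $q_i$ from $j_i-1$ to $j_i$). Set $x_0=H/r$. For $i=1,\dots,k$ put $e_i=v_{q_i}(x_{i-1})$, require $e_i<j_i$, insert successively the still missing prerequisite layers $(q_i,e_i+1),\dots,(q_i,j_i-1)$ followed by $I_i=(q_i,j_i)$, reaching the state $y_i=x_{i-1}q_i^{\,j_i-e_i}$; then execute $D_i$ and put $x_i=y_i/p_i$. Suppose that for every $i$: (a) none of the prerequisite layers $(q_i,e_i+1),\dots,(q_i,j_i-1)$ is one of the later matched layers $I_{i+1},\dots,I_k$; (b) $y_i\le H$; (c) $j_i\le A_i$. After stage $k$, execute all remaining required insertion layers in any stack-admissible order. Then this schedule is an $H'$-admissible geodesic from $H$ to $H'$, and $$\beta^{\mathrm{geo}}(H,H')=\frac12.$$ Moreover, if $q_i>p_i$ for some $i$, then condition (c) for that $i$ holds automatically.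
   Context: $d(n)$ denotes the number of positive divisors of $n$, and $v_q(x)$ the exponent of the prime $q$ in $x$. A positive integer $H$ is highly composite if $d(m)<d(H)$ for all integers $1\le m<H$. Two highly composite numbers $H<H'$ are consecutive if no highly composite number lies strictly between them. A required deletion layer is a pair $(p,j)$ with $p$ prime and $b_p<j\le a_p$, standing for the move lowering the exponent of $p$ from $j$ to $j-1$; a required insertion layer is a pair $(p,j)$ with $a_p<j\le b_p$, standing for the move raising the exponent of $p$ from $j-1$ to $j$. An order of insertion layers is stack-admissible if in each prime coordinate the levels $j$ are inserted in increasing order. An exponent-lattice geodesic from $H$ to $H'$ is a sequence of positive integers starting at $H$ and ending at $H'$ in which each step changes the exponent of exactly one prime by one unit, always in the direction of its target exponent. It is $H'$-admissible if every vertex $z$ satisfies $z\le H'$. The normalised geodesic capacity is $$\beta^{\mathrm{geo}}(H,H')=\frac{1}{d(H)}\max_{\gamma}\min_{z\in\gamma}d(z),$$ where $\gamma$ ranges over the $H'$-admissible geodesics from $H$ to $H'$ and $z$ over all vertices of $\gamma$, endpoints included. *)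

(* Defs.v *)
From mathcomp Require Import all_boot all_order all_algebra.
From mathcomp Require Import boolp.

Set Implicit Arguments.
Unset Strict Implicit.
Unset Printing Implicit Defensive.

Definition ndiv (n : nat) : nat := size (divisors n).

Definition highly_composite (H : nat) : Prop :=
  0 < H /\ forall m, 1 <= m < H -> ndiv m < ndiv H.

Definition consecutive_hc (H H' : nat) : Prop :=
  [/\ highly_composite H, highly_composite H', H < H' &
      forall M, H < M < H' -> ~ highly_composite M].

(* [(p, j)] is the unit move of the exponent of [p] between [j.-1] and [j]. *)
Definition layer : Type := (nat * nat)%type.

Definition required_deletion (H H' : nat) (l : layer) : bool :=
  prime l.1 && (logn l.1 H' < l.2 <= logn l.1 H).

Definition required_insertion (H H' : nat) (l : layer) : bool :=
  prime l.1 && (logn l.1 H < l.2 <= logn l.1 H').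

Definition insertion_stack_admissible (T : seq layer) : bool :=
  pairwise (fun l m => (l.1 == m.1) ==> (l.2 < m.2)) T.

Definition lists (T : seq layer) (P : pred layer) : Prop :=
  uniq T /\ T =i P.

Definition geodesic_step (H' x y : nat) : Prop :=
  exists p, [/\ prime p,
    forall q, prime q -> q != p -> logn q y = logn q x &
    (logn p x < logn p H' /\ logn p y = (logn p x).+1) \/
    (logn p H' < logn p x /\ logn p x = (logn p y).+1)].

(* [g] is the list of all vertices, endpoints included. *)
Definition geodesic (H H' : nat) (g : seq nat) : Prop :=
  [/\ ohead g = Some H, last H g = H', all (fun z => 0 < z) g &
      forall i, i.+1 < size g -> geodesic_step H' (nth 0 g i) (nth 0 g i.+1)].

Definition admissible_geodesic (H H' : nat) (g : seq nat) : Prop :=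
  geodesic H H' g /\ all (fun z => z <= H') g.

Definition min_ndiv (g : seq nat) : nat :=
  \big[minn/ndiv (head 0 g)]_(z <- g) ndiv z.

(* Restricting the maximum to values [c <= ndiv H] loses nothing, since [H]
   is a vertex of every geodesic from [H]. *)
Definition beta_geo (H H' : nat) : rat :=
  ((\max_(c < (ndiv H).+1 |
       `[< exists2 g, admissible_geodesic H H' g & min_ndiv g = c >]) c)%:R
   / (ndiv H)%:R)%R.

(* The stages are numbered from 1: at stage [i] the layers up to [I i] are
   inserted and then the layer [D i] is deleted. Only the values of [D] and
   [I] at [1 <= i <= k] are meaningful. *)

Definition raise_to (x : nat) (l : layer) : nat :=
  x * l.1 ^ (l.2 - logn l.1 x).

Fixpoint stage_x (H r : nat) (D I : nat -> layer) (i : nat) : nat :=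
  if i is i'.+1 then raise_to (stage_x H r D I i') (I i) %/ (D i).1
  else H %/ r.

Definition stage_y (H r : nat) (D I : nat -> layer) (i : nat) : nat :=
  raise_to (stage_x H r D I i.-1) (I i).

Definition stage_e (H r : nat) (D I : nat -> layer) (i : nat) : nat :=
  logn (I i).1 (stage_x H r D I i.-1).

(* The missing prerequisites of [I i], followed by [I i] itself. *)
Definition stage_insertions (H r : nat) (D I : nat -> layer) (i : nat) :
    seq layer :=
  [seq ((I i).1, l) | l <- index_iota (stage_e H r D I i).+1 (I i).2.+1].

(* The successive states after [x], when the layers of [T] are inserted. *)
Definition insertion_states (x : nat) (T : seq layer) : seq nat :=
  scanl (fun z l => z * l.1) x T.

Definition stage_states (H r : nat) (D I : nat -> layer) (i : nat) : seq nat :=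
  rcons (insertion_states (stage_x H r D I i.-1) (stage_insertions H r D I i))
        (stage_x H r D I i).

Definition remaining_insertion (H H' r k : nat) (D I : nat -> layer)
    (l : layer) : bool :=
  required_insertion H H' l &&
  (l \notin flatten [seq stage_insertions H r D I i | i <- iota 1 k]).

Definition schedule (H r k : nat) (D I : nat -> layer) (T : seq layer) :
    seq nat :=
  [:: H, H %/ r & flatten [seq stage_states H r D I i | i <- iota 1 k]
                  ++ insertion_states (stage_x H r D I k) T].

(* Main.v *)
Require Import Defs.
From mathcomp Require Import all_boot all_order all_algebra.
From mathcomp Require Import boolp zify ring.

Set Implicit Arguments.
Unset Strict Implicit.
Unset Printing Implicit Defensive.

(** Deleting [r] first halves the number of divisors. Stage [i] multiplies it
    by [(j + 1) / (e + 1) * (A / (A + 1)) >= 1], because [e < j <= A], so the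
    schedule never drops below half of [ndiv H]; its states are bounded by [H]
    until stage [k], and afterwards they divide [H']. Conversely every admissible
    geodesic deletes [r] at some vertex [u] below [H'], where [ndiv u <= ndiv H]
    since [H] and [H'] are consecutive, and the next vertex has [ndiv u / 2]
    divisors. Condition (c) for [q > p] comes from the exponents of the highly
    composite number [H'] being nonincreasing: [j <= b_q <= b_p < A]. *)

(** * The divisor count as a product over primes *)

Lemma ndiv_primes n : ndiv n = \prod_(p <- primes n) (logn p n).+1.
Proof.
rewrite /ndiv /divisors prime_decompE.
elim: (primes n) => [|p s IHs] /=; first by rewrite big_nil.
rewrite big_cons -{}IHs; set t := foldr _ _ _.
(* [divisors] treats a prime of exponent e by e iterated merges, each adding one more copy of the
   list [t] built so far; hence the factor e + 1. *)
elim: (logn p n) => [|e IHe]; first by rewrite mul1n.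
by rewrite /= size_merge size_cat size_map IHe; lia.
Qed.

(** An index range independent of the support of [n] lets two numbers with different prime factors
    be compared factor by factor. *)
Lemma ndiv_prod n N : 0 < n < N ->
  ndiv n = \prod_(p < N | prime p) (logn p n).+1.
Proof.
case/andP=> n_gt0 ltnN.
rewrite ndiv_primes -(big_mkord prime (fun p => (logn p n).+1)).
rewrite (perm_big [seq p <- index_iota 0 N | p \in primes n]) /=.
  rewrite big_filter big_mkcond [RHS]big_mkcond; apply: eq_bigr => p _.
  case: ifP => [|nr]; first by rewrite mem_primes => /andP[->].
  case: ifP => // p_pr; rewrite lognE p_pr n_gt0.
  by move: nr; rewrite mem_primes p_pr n_gt0 /= => ->.
apply: uniq_perm; rewrite ?primes_uniq ?filter_uniq ?iota_uniq // => p.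
rewrite mem_filter mem_index_iota /=.
case: (boolP (p \in primes n)) => //=; rewrite mem_primes => /and3P[_ _ pn].
by rewrite (leq_ltn_trans (dvdn_leq _ pn)).
Qed.

(** All factors except the one at [p] cancel; the ratio is cross-multiplied to stay in [nat]. *)
Lemma ndiv_ratio x y p : 0 < x -> 0 < y -> prime p ->
  (forall q, prime q -> q != p -> logn q y = logn q x) ->
  ndiv x * (logn p y).+1 = ndiv y * (logn p x).+1.
Proof.
move=> x_gt0 y_gt0 p_pr eq_log.
rewrite !(@ndiv_prod _ (x + y + p).+1); [|lia..].
have p_lt : p < (x + y + p).+1 by lia.
rewrite (bigD1 (Ordinal p_lt)) //= [in RHS](bigD1 (Ordinal p_lt)) //=.
rewrite [X in _ * X * _](eq_bigr (fun q : 'I__ => (logn q y).+1)); first by lia.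
by move=> q /andP[q_pr q_ne]; rewrite eq_log.
Qed.

Lemma logn_mulp p q x : prime p -> prime q -> 0 < x ->
  logn q (x * p) = logn q x + (q == p).
Proof. by move=> p_pr q_pr x_gt0; rewrite lognM ?(logn_prime _ p_pr) ?(prime_gt0 p_pr). Qed.

Lemma ndiv_gt0 n : 0 < ndiv n.
Proof. by rewrite ndiv_primes prodn_gt0. Qed.


Lemma ndiv_mulp p x : prime p -> 0 < x ->
  ndiv (x * p) * (logn p x).+1 = ndiv x * (logn p x).+2.
Proof.
move=> p_pr x_gt0; have xp_gt0 : 0 < x * p by rewrite muln_gt0 x_gt0 prime_gt0.
rewrite -(@ndiv_ratio x (x * p) p) // ?logn_mulp // ?eqxx ?addn1 //.
by move=> q q_pr /negPf q_ne; rewrite logn_mulp // q_ne addn0.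
Qed.

Lemma leq_ndiv_mulp p x : prime p -> 0 < x -> ndiv x <= ndiv (x * p).
Proof. by move=> p_pr x_gt0; have := ndiv_mulp p_pr x_gt0; nia. Qed.

(** * Exponents and divisor counts around highly composite numbers *)

Lemma logn_hc n p q : highly_composite n -> prime p -> prime q -> p < q ->
  logn q n <= logn p n.
Proof.
case=> n_gt0 n_max p_pr q_pr ltpq; rewrite leqNgt; apply/negP => ltab.
set a := logn p n in ltab; set b := logn q n in ltab.
have qn : q ^ (b - a) %| n by rewrite pfactor_dvdn // leq_subr.
have [w def_n] := dvdnP qn.
have w_gt0 : 0 < w by move: n_gt0; rewrite def_n muln_gt0 => /andP[].
have exp_gt0 s : prime s -> 0 < s ^ (b - a).
  by move=> s_pr; rewrite expn_gt0 prime_gt0.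
have log_mul s t : prime s -> prime t ->
    logn t (w * s ^ (b - a)) = logn t w + (b - a) * (t == s).
  by move=> s_pr t_pr; rewrite lognM ?exp_gt0 // lognX (logn_prime _ s_pr).
have [npq nqp] : (p == q) = false /\ (q == p) = false by lia.
have aE : a = logn p w by rewrite /a def_n log_mul // npq muln0 addn0.
have bE : b = logn q w + (b - a) by rewrite {1}/b def_n log_mul // eqxx muln1.
(* [n'] is [n] with the exponents of [p] and [q] exchanged. Both exponents are [a] in [w], so [n]
   and [n'] each have (b + 1) / (a + 1) times as many divisors as [w]; but [n'] is smaller than
   [n]. *)
pose n' := w * p ^ (b - a).
have n'_gt0 : 0 < n' by rewrite muln_gt0 w_gt0 exp_gt0.
have nn' : n' < n by rewrite def_n ltn_pmul2l // ltn_exp2r // subn_gt0.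
have := n_max n'; rewrite n'_gt0 nn' => /(_ isT).
have En : ndiv w * b.+1 = ndiv n * a.+1.
  rewrite (_ : a = logn q w); last by lia.
  by apply: ndiv_ratio => // t t_pr /negPf tq; rewrite def_n log_mul // tq; lia.
have En' : ndiv w * b.+1 = ndiv n' * a.+1.
  rewrite aE (_ : b = logn p n'); last by rewrite log_mul // eqxx; lia.
  by apply: ndiv_ratio => // t t_pr /negPf tp; rewrite log_mul // tp; lia.
by nia.
Qed.

(** The least number with more divisors than [H] is highly composite. If it were at most [z], it
    would lie strictly between [H] and [H']. *)
Lemma leq_ndiv_consecutive H H' z : consecutive_hc H H' ->
  0 < z < H' -> ndiv z <= ndiv H.
Proof.
case=> [[H_gt0 H_max] _ _ no_hc] /andP[z_gt0 zH'].
rewrite leqNgt; apply/negP => z_big.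
have ex_big : exists m, (0 < m) && (ndiv H < ndiv m) by exists z; rewrite z_gt0.
case: (ex_minnP ex_big) => m /andP[m_gt0 m_big] m_min.
apply: (no_hc m).
  rewrite (leq_ltn_trans (m_min z _)) ?z_gt0 // andbT ltnNge leq_eqVlt.
  apply/negP => /orP[/eqP Em | ltmH]; first by rewrite Em ltnn in m_big.
  by have := H_max m; rewrite m_gt0 ltmH => /(_ isT); lia.
split=> // m' /andP[m'_gt0 ltm'm]; apply: leq_ltn_trans m_big.
by rewrite leqNgt; apply/negP => m'_big; have := m_min m'; rewrite m'_gt0 m'_big; lia.
Qed.

(** * Unit steps in the exponent lattice and runs of insertions *)

Definition lattice_step (H' : nat) : rel nat :=
  fun x y => `[< geodesic_step H' x y >].

Lemma lattice_step_mul H' x p : prime p -> 0 < x -> logn p x < logn p H' ->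
  lattice_step H' x (x * p).
Proof.
move=> p_pr x_gt0 lt_log; apply/asboolP; exists p; split=> //.
  by move=> q q_pr /negPf q_ne; rewrite logn_mulp // q_ne addn0.
by left; rewrite logn_mulp // eqxx addn1.
Qed.

Lemma lattice_step_div H' x p : prime p -> 0 < x -> logn p H' < logn p (x * p) ->
  lattice_step H' (x * p) x.
Proof.
move=> p_pr x_gt0 lt_log; apply/asboolP; exists p; split=> //.
  by move=> q q_pr /negPf q_ne; rewrite logn_mulp // q_ne addn0.
by right; split=> //; rewrite logn_mulp // eqxx addn1.
Qed.

Lemma eq_of_logn m n : 0 < m -> 0 < n ->
  (forall p, prime p -> logn p m = logn p n) -> m = n.
Proof.
move=> m_gt0 n_gt0 eq_log; apply: eqn_from_log => // p /=.
by case: (boolP (prime p)) => [/eq_log // | /negPf np]; rewrite (lognE p m) (lognE p n) np.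
Qed.

(* A stack-admissible order of the layers between [z] and [y] inserts them one
   level at a time: the first layer listed for a prime [q] can only be
   [(q, (logn q z).+1)], and the hypotheses then hold for [z * q] and the tail. *)
Lemma insertion_statesP H' y z T :
    0 < z -> 0 < y ->
    (forall q, prime q -> logn q z <= logn q y) ->
    (forall q, prime q -> logn q z < logn q y -> logn q y <= logn q H') ->
    lists T (fun l => prime l.1 && (logn l.1 z < l.2 <= logn l.1 y)) ->
    insertion_stack_admissible T ->
  [/\ path (lattice_step H') z (insertion_states z T),
      last z (insertion_states z T) = y, z <= y &
      all (fun w => (0 < w <= y) && (ndiv z <= ndiv w)) (insertion_states z T)].
Proof.
elim: T z => [|[q j] T IH] z z_gt0 y_gt0 le_zy le_yH' [uniqT listT] /=.
  move=> _; suff -> : z = y by [].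
  apply: eq_of_logn => // p p_pr; apply/eqP; rewrite eqn_leq le_zy // leqNgt.
  apply/negP => lt_log; have := listT (p, logn p y).
  by rewrite in_nil unfold_in /= p_pr lt_log leqnn.
case/andP=> minT stackT; move: uniqT => /= /andP[notT uniqT].
have := listT (q, j); rewrite mem_head unfold_in /= => /esym/and3P[q_pr ltzj lejy].
have jE : j = (logn q z).+1.
  apply/eqP; rewrite eqn_leq ltzj andbT leqNgt; apply/negP => ltj.
  have := listT (q, (logn q z).+1); rewrite [in RHS]unfold_in /= q_pr ltnSn /=.
  rewrite (leq_trans ltzj lejy) inE => /orP[/eqP[]|]; first by lia.
  by move/(allP minT); rewrite /= eqxx /=; lia.
have zq_gt0 : 0 < z * q by rewrite muln_gt0 z_gt0 prime_gt0.
have [] := IH (z * q) zq_gt0 y_gt0; rewrite //.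
- move=> p p_pr; rewrite logn_mulp //; case: eqP => [->|_]; first by lia.
  by rewrite addn0 le_zy.
- by move=> p p_pr; rewrite logn_mulp // => ?; apply: le_yH' => //; lia.
- split=> // -[p l]; rewrite [RHS]unfold_in /=.
  have : ((p, l) == (q, j)) || ((p, l) \in T) =
      prime p && (logn p z < l <= logn p y) by rewrite -in_cons listT.
  case: (boolP ((p, l) == (q, j))) => [/eqP[-> ->] _|ne_l] /=.
    by rewrite (negPf notT) logn_mulp // eqxx jE addn1 ltnn andbF.
  move=> ->; case: (boolP (prime p)) => //= p_pr; rewrite logn_mulp //.
  by case: (eqVneq p q) ne_l => [->|_ _]; rewrite ?addn0 // xpair_eqE eqxx jE /=; lia.
move=> pathT lastT le_zqy allT.
have le_ndiv : ndiv z <= ndiv (z * q) by apply: leq_ndiv_mulp.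
split=> //.
- by rewrite lattice_step_mul //; apply: leq_trans (le_yH' q q_pr _); lia.
- by apply: leq_trans le_zqy; rewrite leq_pmulr ?prime_gt0.
rewrite zq_gt0 le_zqy le_ndiv /=; apply: sub_all allT => w /andP[-> /=].
exact: leq_trans.
Qed.

(** The arithmetic of one stage: [a], [b], [c] are the divisor counts before the insertions, after
    them and after the deletion. The gain (j + 1) / (e + 1) is at least (j + 1) / j, which is at
    least the loss factor (A + 1) / A because j <= A. *)
Lemma leq_of_ratios a b c e j A : e < j -> j <= A ->
  a * j.+1 = b * e.+1 -> b * A = c * A.+1 -> a <= c.
Proof.
move=> lt_ej le_jA ab bc.
have le_ab : a * j.+1 <= b * j by rewrite ab leq_mul2l lt_ej orbT.
have Aj_gt0 : 0 < A.+1 * j by rewrite muln_gt0; lia.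
rewrite -(leq_pmul2r Aj_gt0) [c * _]mulnA -bc.
have le_Aj : A.+1 * j <= j.+1 * A by rewrite !mulSn [j * A]mulnC leq_add2r.
apply: leq_trans (leq_mul (leqnn a) le_Aj) _.
by rewrite mulnA [b * _ * _]mulnAC leq_mul2r le_ab orbT.
Qed.

Lemma iota1S n : iota 1 n.+1 = iota 1 n ++ [:: n.+1].
Proof. by rewrite -(addn1 n) iotaD add1n addn1. Qed.

(** * The stages of the schedule and their invariant *)

Section Stages.

Variables (H H' r k : nat) (D I : nat -> layer).
Hypothesis H_gt0 : 0 < H.
Hypotheses (r_prime : prime r) (ar : logn r H = 1) (br : logn r H' = 0).
Hypothesis D_lists : lists [seq D i | i <- iota 1 k]
  (fun l => required_deletion H H' l && (l != (r, 1))).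
Hypothesis D_stack : forall i h, 1 <= i -> i < h -> h <= k ->
  (D i).1 = (D h).1 -> (D h).2 < (D i).2.
Hypothesis I_required : forall i, 1 <= i <= k -> required_insertion H H' (I i).
Hypothesis e_lt_j : forall i, 1 <= i <= k -> stage_e H r D I i < (I i).2.

Local Notation x := (stage_x H r D I).
Local Notation y := (stage_y H r D I).
Local Notation inserted i :=
  (flatten [seq stage_insertions H r D I h | h <- iota 1 i]).

Lemma stage0_mulr : x 0 * r = H.
Proof.
by rewrite divnK // -(expn1 r) pfactor_dvdn // ar.
Qed.

(** The last two clauses tie exponents to history: a level lies under the current exponent exactly
    when its deletion is still pending, or its insertion already done. The prime [r] is set apart
    because its only layer is gone before stage 1 and is absent from [D]. *)
Definition stage_inv (i : nat) : Prop :=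
  [/\ 0 < x i, logn r (x i) = 0,
      forall q, prime q -> q != r ->
        minn (logn q H) (logn q H') <= logn q (x i)
          <= maxn (logn q H) (logn q H'),
      forall l, required_deletion H H' l -> l != (r, 1) ->
        (l.2 <= logn l.1 (x i)) = (l \notin [seq D h | h <- iota 1 i]) &
      forall l, required_insertion H H' l ->
        (l.2 <= logn l.1 (x i)) = (l \in inserted i)].

Lemma mem_stage_insertions i l :
  (l \in stage_insertions H r D I i) =
  (l.1 == (I i).1) && (stage_e H r D I i < l.2 <= (I i).2).
Proof.
case: l => t m /=; apply/mapP/andP => [[n n_in [-> ->]] | [/eqP-> m_in]].
  by rewrite eqxx; move: n_in; rewrite mem_index_iota ltnS.
by exists m; rewrite // mem_index_iota ltnS.
Qed.

Lemma stage_deletionP i : 1 <= i <= k ->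
  [/\ prime (D i).1, (D i).1 != r &
      logn (D i).1 H' < (D i).2 <= logn (D i).1 H].
Proof.
move=> i_in; have /esym := (D_lists.2 (D i)).
rewrite map_f ?mem_iota; last by lia.
rewrite unfold_in; case: (D i) => p A /= /andP[/andP[/= p_pr lev] ne].
split=> //; apply: contraNneq ne => p_r.
by rewrite xpair_eqE p_r eqxx /=; move: lev; rewrite p_r ar br; lia.
Qed.

(** The next layer to delete is on top of its stack. A level just above it that was still present
    would be listed later, against the decreasing order of [D]; and the layer itself cannot have
    been deleted earlier, since levels of one prime strictly decrease along [D]. *)
Lemma stage_deletion_level i : i < k -> stage_inv i ->
  logn (D i.+1).1 (x i) = (D i.+1).2.
Proof.
move=> lt_ik [_ _ bounds delE _].
have i_in : 1 <= i.+1 <= k by [].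
have [p_pr p_r lev] := stage_deletionP i_in.
have req m : (D i.+1).2 <= m <= logn (D i.+1).1 H ->
    required_deletion H H' ((D i.+1).1, m) /\ ((D i.+1).1, m) != (r, 1).
  by rewrite /required_deletion xpair_eqE (negPf p_r) p_pr /=; lia.
apply/eqP; rewrite eqn_leq; apply/andP; split.
  rewrite leqNgt; apply/negP => lt_lev.
  have [|req1 ne1] := req (D i.+1).2.+1.
    by have := bounds _ p_pr p_r; lia.
  have := D_lists.2 ((D i.+1).1, (D i.+1).2.+1).
  rewrite [RHS]unfold_in /= req1 ne1 => /mapP[h].
  rewrite mem_iota => h_in Dh.
  have := delE _ req1 ne1; rewrite lt_lev => /esym/mapP notD.
  have lt_ih : i < h.
    rewrite ltnNge; apply/negP => le_hi; case: notD; exists h => //.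
    by rewrite mem_iota; lia.
  case: (ltngtP i.+1 h) lt_ih => // [lt_ih|eq_h] _.
    by have := @D_stack i.+1 h isT lt_ih; rewrite -Dh /=; lia.
  by move: Dh; rewrite -eq_h; case: (D i.+1) => p A [] /=; lia.
have [|req0 ne0] := req (D i.+1).2; first by lia.
rewrite (delE _ req0 ne0); apply/mapP => -[h]; rewrite mem_iota => h_in Dh.
by have := @D_stack h i.+1; rewrite -Dh /=; lia.
Qed.

Lemma stageP i : i < k -> stage_inv i ->
  [/\ 0 < x i.+1, y i.+1 = x i.+1 * (D i.+1).1,
      (logn (D i.+1).1 (x i.+1)).+1 = (D i.+1).2 &
      forall t, prime t ->
        logn t (y i.+1) = if t == (I i.+1).1 then (I i.+1).2 else logn t (x i)].
Proof.
move=> lt_ik inv_i; have [x_gt0 _ _ _ _] := inv_i.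
have i_in : 1 <= i.+1 <= k by [].
have [p_pr p_r lev] := stage_deletionP i_in.
have /andP[q_pr lev_q] := I_required i_in.
have lt_ej := e_lt_j i_in; rewrite /stage_e /= in lt_ej.
have exp_gt0 : 0 < (I i.+1).1 ^ ((I i.+1).2 - logn (I i.+1).1 (x i)).
  by rewrite expn_gt0 prime_gt0.
have y_gt0 : 0 < y i.+1 by rewrite muln_gt0 x_gt0.
have logy t : prime t ->
    logn t (y i.+1) = if t == (I i.+1).1 then (I i.+1).2 else logn t (x i).
  move=> t_pr; rewrite lognM //= lognX (logn_prime _ q_pr).
  by case: eqP => [->|_]; lia.
(* No prime requires both deletions and insertions, so the insertions of this stage leave the
   exponent of the deleted prime alone. *)
have logpy : logn (D i.+1).1 (y i.+1) = (D i.+1).2.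
  rewrite logy //; case: eqP => [pq|_]; last exact: stage_deletion_level.
  by move: lev lev_q; rewrite -pq; lia.
(* The division defining [x i.+1] is exact, since the deleted level is positive. *)
have yE : y i.+1 = x i.+1 * (D i.+1).1.
  rewrite [x _]/(y i.+1 %/ _) divnK // -(expn1 (D _).1) pfactor_dvdn // logpy.
  by lia.
have x'_gt0 : 0 < x i.+1 by move: y_gt0; rewrite yE muln_gt0 => /andP[].
by split=> //; rewrite -[RHS]logpy yE logn_mulp // eqxx addn1.
Qed.

Lemma stage_invS i : i < k -> stage_inv i -> stage_inv i.+1.
Proof.
move=> lt_ik inv_i; have [x_gt0 logr bounds delE insE] := inv_i.
have i_in : 1 <= i.+1 <= k by [].
have [p_pr p_r lev_p] := stage_deletionP i_in.
have /andP[q_pr lev_q] := I_required i_in.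
have [x'_gt0 yE logp logy] := stageP lt_ik inv_i.
have levp := stage_deletion_level lt_ik inv_i.
have lt_ej := e_lt_j i_in; rewrite /stage_e /= in lt_ej.
have npq : (D i.+1).1 != (I i.+1).1.
  by apply/eqP => pq; move: lev_p lev_q; rewrite pq; lia.
(* The effect of the whole stage on each exponent, with the deletion added on the left to avoid
   truncated subtraction. *)
have logx' t : prime t -> logn t (x i.+1) + (t == (D i.+1).1) =
    if t == (I i.+1).1 then (I i.+1).2 else logn t (x i).
  by move=> t_pr; rewrite -logy // yE logn_mulp.
split=> //.
- have := logx' r r_prime; rewrite logr.
  have -> : (r == (I i.+1).1) = false.
    by apply/eqP => rq; move: lev_q; rewrite -rq br; lia.
  by lia.
- move=> t t_pr t_r; have := bounds t t_pr t_r; have := logx' t t_pr.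
  case: (eqVneq t (I i.+1).1) npq => [-> | _ _].
    by rewrite eq_sym => /negPf->; lia.
  by case: eqP => [-> | _]; lia.
- move=> [t m] req ne; rewrite iota1S map_cat mem_cat negb_or.
  rewrite -(delE _ req ne) /= inE /=.
  case/andP: req => /= t_pr lev_t; have := logx' t t_pr.
  case: (eqVneq t (I i.+1).1) => [tq | _].
    by move: lev_t; rewrite tq; lia.
  rewrite [D i.+1]surjective_pairing xpair_eqE /=.
  by case: eqP => [tp | _] /=; [rewrite -tp in levp logp *; lia | rewrite andbT; lia].
move=> [t m] req; rewrite iota1S map_cat flatten_cat mem_cat.
rewrite -(insE _ req) /= cats0 mem_stage_insertions /stage_e /=.
case/andP: req => /= t_pr lev_t; have := logx' t t_pr.
have -> : (t == (D i.+1).1) = false.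
  by apply/eqP => tp; move: lev_t lev_p; rewrite tp; lia.
by case: eqP => [-> | _] /=; lia.
Qed.

Lemma stage_invP i : i <= k -> stage_inv i.
Proof.
elim: i => [_ | i IHi lt_ik]; last by apply: stage_invS => //; apply/IHi/ltnW.
have x_gt0 : 0 < x 0 by move: H_gt0; rewrite -{1}stage0_mulr muln_gt0 => /andP[].
have logH t : prime t -> logn t H = logn t (x 0) + (t == r).
  by move=> t_pr; rewrite -{1}stage0_mulr logn_mulp.
split=> //.
- by have /= := logH r r_prime; rewrite ar eqxx; lia.
- by move=> q q_pr /negPf q_r; rewrite logH // q_r; lia.
- case=> t m /andP[/= t_pr]; rewrite logH // xpair_eqE /=.
  by case: eqP => [-> | _]; rewrite ?br; have /= := logH r r_prime; rewrite ar eqxx; lia.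
case=> t m /andP[/= t_pr]; rewrite logH //= in_nil; lia.
Qed.

(** The insertion states increase up to [y i.+1], so (b) bounds them all by [H]. They have at least
    as many divisors as [x i], and (c) preserves this bound through the final deletion. *)
Lemma stage_states_path i : i < k -> y i.+1 <= H ->
  (I i.+1).2 <= (D i.+1).2 ->
  [/\ path (lattice_step H') (x i) (stage_states H r D I i.+1),
      last (x i) (stage_states H r D I i.+1) = x i.+1,
      ndiv (x i) <= ndiv (x i.+1) &
      all (fun w => (0 < w <= H) && (ndiv (x i) <= ndiv w))
        (stage_states H r D I i.+1)].
Proof.
move=> lt_ik le_yH le_jA; have inv_i := stage_invP (ltnW lt_ik).
have [x_gt0 logr bounds delE insE] := inv_i.
have i_in : 1 <= i.+1 <= k by [].
have [p_pr p_r lev_p] := stage_deletionP i_in.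
have /andP[q_pr lev_q] := I_required i_in.
have [x'_gt0 yE logp logy] := stageP lt_ik inv_i.
have lt_ej := e_lt_j i_in; rewrite /stage_e /= in lt_ej.
have y_gt0 : 0 < y i.+1 by rewrite yE muln_gt0 x'_gt0 prime_gt0.
have le_ndiv : ndiv (x i) <= ndiv (x i.+1).
  have := ndiv_mulp p_pr x'_gt0; rewrite -yE logp.
  have := @ndiv_ratio (x i) (y i.+1) _ x_gt0 y_gt0 q_pr.
  rewrite (logy _ q_pr) eqxx => ratio_q ratio_p.
  apply: leq_of_ratios lt_ej le_jA (ratio_q _) ratio_p.
  by move=> t t_pr /negPf t_q; rewrite logy // t_q.
(* The stage insertions fill exactly the gap between [x i] and [y i.+1], all of it at the prime of
   [I i.+1]. *)
have [||||] := @insertion_statesP H' (y i.+1) (x i) (stage_insertions H r D I i.+1) x_gt0 y_gt0.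
- by move=> t t_pr; rewrite logy //; case: eqP => [->|]; lia.
- by move=> t t_pr; rewrite logy //; case: eqP => [->|]; lia.
- split=> [|l]; first by rewrite map_inj_uniq ?iota_uniq // => a b [].
  rewrite mem_stage_insertions /stage_e /= [RHS]unfold_in.
  case: (boolP (prime l.1)) => [l_pr | l_npr] /=.
    by rewrite logy //; case: eqP => [->|]; lia.
  by case: eqP l_npr => // ->; rewrite q_pr.
- rewrite /insertion_stack_admissible pairwise_map.
  rewrite (@sub_pairwise _ ltn) //=; first by move=> a b /=; rewrite eqxx.
  by rewrite -sorted_pairwise ?iota_ltn_sorted //; apply: ltn_trans.
move=> pathT lastT _ allT; rewrite /stage_states /= in pathT lastT allT *.
have le_x'H : x i.+1 <= H.
  by apply: leq_trans le_yH; rewrite yE leq_pmulr ?prime_gt0.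
split=> //.
- rewrite rcons_path pathT lastT [in X in lattice_step _ X]yE.
  by apply: lattice_step_div => //; rewrite logn_mulp // eqxx; lia.
- by rewrite last_rcons.
rewrite all_rcons x'_gt0 le_ndiv le_x'H /=.
by apply: sub_all allT => w; lia.
Qed.

Lemma stages_path m :
    (forall i, 1 <= i <= k -> y i <= H) ->
    (forall i, 1 <= i <= k -> (I i).2 <= (D i).2) -> m <= k ->
  let s := flatten [seq stage_states H r D I i | i <- iota 1 m] in
  [/\ path (lattice_step H') (x 0) s, last (x 0) s = x m,
      ndiv (x 0) <= ndiv (x m) &
      all (fun w => (0 < w <= H) && (ndiv (x 0) <= ndiv w)) s].
Proof.
move=> le_yH le_jA; elim: m => [_ // | m IHm lt_mk].
have [path_s last_s le_m all_s] := IHm (ltnW lt_mk).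
have [||path_m last_m le_mS all_m] := @stage_states_path m lt_mk.
- exact: le_yH.
- exact: le_jA.
move=> s; have {s}-> : s = flatten [seq stage_states H r D I i | i <- iota 1 m]
    ++ stage_states H r D I m.+1.
  by rewrite /s iota1S map_cat flatten_cat /= cats0.
split.
- by rewrite cat_path path_s last_s.
- by rewrite last_cat last_s.
- exact: leq_trans le_m le_mS.
rewrite all_cat all_s; apply: sub_all all_m => w /andP[-> /=].
exact: leq_trans.
Qed.

Lemma leq_logn_last_stage q : prime q -> logn q (x k) <= logn q H'.
Proof.
move=> q_pr; have [_ logr bounds delE _] := stage_invP (leqnn k).
case: (eqVneq q r) => [-> | q_r]; first by rewrite logr.
case: (leqP (logn q H) (logn q H')) => [le_ab | lt_ba].
  by have := bounds q q_pr q_r; lia.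
(* This is the lowest required deletion layer of [q]. It is listed in [D], and once it is gone the
   exponent is at most its target. *)
have req : required_deletion H H' (q, (logn q H').+1).
  by rewrite /required_deletion q_pr ltnSn.
have ne : (q, (logn q H').+1) != (r, 1) by rewrite xpair_eqE (negPf q_r).
have := D_lists.2 (q, (logn q H').+1); rewrite [RHS]unfold_in /= req ne => D_in.
by have := delE _ req ne; rewrite D_in /=; lia.
Qed.

(** This puts the remaining layers in the form expected by [insertion_statesP], as the gap between
    [x k] and [H']. A prime with no required insertion has already reached its target exponent in
    [x k], so it contributes nothing. *)
Lemma remaining_insertionE l : remaining_insertion H H' r k D I l =
  prime l.1 && (logn l.1 (x k) < l.2 <= logn l.1 H').
Proof.
have [_ logr bounds _ insE] := stage_invP (leqnn k).
rewrite /remaining_insertion; case: (boolP (required_insertion H H' l)) => [req|].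
  rewrite -(insE l req) -ltnNge; case/andP: req => -> /andP[_ ->].
  by rewrite andbT.
case: l => q j; rewrite /required_insertion /=.
case: (boolP (prime q)) => //= q_pr; have := leq_logn_last_stage q_pr.
case: (eqVneq q r) => [-> | q_r]; first by rewrite br; lia.
by have := bounds q q_pr q_r; lia.
Qed.

Lemma ndiv_source : ndiv H = 2 * ndiv (x 0).
Proof.
have [x_gt0 logr _ _ _] := stage_invP (leq0n k).
by have := ndiv_mulp r_prime x_gt0; rewrite stage0_mulr logr; lia.
Qed.

Lemma schedule_admissible T :
    H <= H' ->
    (forall i, 1 <= i <= k -> y i <= H) ->
    (forall i, 1 <= i <= k -> (I i).2 <= (D i).2) ->
    lists T (remaining_insertion H H' r k D I) ->
    insertion_stack_admissible T ->
  admissible_geodesic H H' (schedule H r k D I T) /\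
  all (fun z => ndiv H <= 2 * ndiv z) (schedule H r k D I T).
Proof.
move=> leHH' le_yH le_jA [uniqT memT] stackT.
have [x0_gt0 logr _ _ _] := stage_invP (leq0n k).
have [xk_gt0 _ _ _ _] := stage_invP (leqnn k).
have [path_s last_s le_0k all_s] := stages_path le_yH le_jA (leqnn k).
have H'_gt0 : 0 < H' by apply: leq_trans leHH'.
have listT : lists T
    (fun l => prime l.1 && (logn l.1 (x k) < l.2 <= logn l.1 H')).
  by split=> // l; rewrite memT; apply: remaining_insertionE.
(* With target [H'] itself, the bound on the insertion states is the required [z <= H']. *)
have [path_T last_T _ all_T] :=
  @insertion_statesP H' H' (x k) T xk_gt0 H'_gt0 leq_logn_last_stage
    (fun q _ _ => leqnn _) listT stackT.
have le_x0H : x 0 <= H by exact: leq_div.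
pose w := H %/ r :: flatten [seq stage_states H r D I i | i <- iota 1 k]
            ++ insertion_states (x k) T.
have all_w : all (fun z => (0 < z <= H') && (ndiv H <= 2 * ndiv z)) w.
  rewrite /= all_cat ndiv_source; apply/and3P; split.
  - by rewrite x0_gt0 leqnn andbT (leq_trans le_x0H).
  - by apply: sub_all all_s => z; lia.
  by apply: sub_all all_T => z; lia.
have path_w : path (lattice_step H') H w.
  rewrite /= cat_path path_s last_s path_T !andbT -{1}stage0_mulr.
  by apply: lattice_step_div => //; rewrite stage0_mulr ar br.
rewrite /schedule -/w; split; last first.
  rewrite /= leq_pmull //; apply: sub_all all_w => z /andP[_].
  exact.
split; last by rewrite /= leHH'; apply: sub_all all_w => z; lia.
split=> //.
- by rewrite /= last_cat last_s.
- by rewrite /= H_gt0; apply: sub_all all_w => z; lia.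
move=> i lt_i; apply/asboolP.
by have /pathP := path_w; apply.
Qed.

End Stages.

(** * Existence of an insertion order, and the upper bound for every geodesic *)

Lemma exists_insertion_order (P : pred layer) N :
  (forall l, P l -> (l.1 < N) && (l.2 < N)) ->
  exists2 T, lists T P & insertion_stack_admissible T.
Proof.
move=> ltN; pose s := [seq l <- allpairs pair (iota 0 N) (iota 0 N) | P l].
pose le2 (l m : layer) := l.2 <= m.2.
have uniq_s : uniq s.
  by rewrite filter_uniq // allpairs_uniq ?iota_uniq // => -[a b] [c d] _ _ [-> ->].
exists (sort le2 s).
  split=> [|l]; first by rewrite sort_uniq.
  rewrite mem_sort mem_filter [RHS]unfold_in.
  case: (boolP (P l)) => //= /ltN/andP[l1 l2].
  by rewrite [l]surjective_pairing allpairs_f ?mem_iota.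
have tot2 : total le2 by move=> l m; exact: leq_total.
have tr2 : transitive le2 by move=> l m n; exact: leq_trans.
have := sort_sorted tot2 s; rewrite (sorted_pairwise tr2) => le_s.
have ne_s : pairwise [rel l m | l != m] (sort le2 s).
  by rewrite -uniq_pairwise sort_uniq.
(* Sorting by level alone suffices: two distinct layers of the same prime have different levels, so
   the weak order becomes strict there. *)
have := conj le_s ne_s => /andP; rewrite -pairwise_relI.
apply: sub_pairwise => -[a b] [c d] /=; rewrite /le2 xpair_eqE /=.
by case: (a == c); lia.
Qed.

(** The induction picks the first step at which the exponent of [r] becomes zero. *)
Lemma path_logn_vanishes H' r z s : prime r -> logn r H' = 0 ->
  path (lattice_step H') z s -> logn r z != 0 -> logn r (last z s) = 0 ->
  exists u v, [/\ u \in z :: s, v \in s, lattice_step H' u v,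
                  logn r u != 0 & logn r v = 0].
Proof.
move=> r_pr br; elim: s z => [|v s IHs] z /=; first by move=> _ /eqP.
case/andP=> step_zv path_s z_r last_r.
case: (eqVneq (logn r v) 0) => [v0 | v_r].
  by exists z, v; rewrite !inE !eqxx.
have [u [w [u_in w_in step_uw u_r w_r]]] := IHs v path_s v_r last_r.
by exists u, w; split; rewrite // inE ?u_in ?w_in orbT.
Qed.

Lemma geodesic_path H H' g : geodesic H H' g ->
  exists2 s, g = H :: s & path (lattice_step H') H s /\ last H s = H'.
Proof.
case: g => [|z s] [] //= [->] last_s _ steps; exists s => //; split=> //.
by apply/(pathP 0) => i lt_i; apply/asboolP; exact: steps.
Qed.

(* Deleting [r] halves [ndiv]; the vertex before that is divisible by [r], hence
   is not [H'] and has at most [ndiv H] divisors. *)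
Lemma geodesic_low_vertex H H' r g : consecutive_hc H H' -> prime r ->
    logn r H = 1 -> logn r H' = 0 -> admissible_geodesic H H' g ->
  exists2 z, z \in g & 2 * ndiv z <= ndiv H.
Proof.
move=> cons r_pr ar br [geo_g /allP le_g].
have [_ _ /allP pos_g _] := geo_g.
have [s def_g [path_s last_s]] := geodesic_path geo_g.
have [||u [v [u_in v_in /asboolP[p [p_pr eq_log lev_p]] u_r v_r]]] :=
  path_logn_vanishes r_pr br path_s; rewrite ?ar ?last_s //.
have v_g : v \in g by rewrite def_g inE v_in orbT.
have u_g : u \in g by rewrite def_g.
have [u_gt0 v_gt0] : 0 < u /\ 0 < v by split; exact: pos_g.
(* The step changes the exponent of [r], and it moves only one prime. *)
have def_p : p = r.
  by apply/eqP; apply/negPn/negP => pr; move: u_r; rewrite -eq_log ?v_r // eq_sym.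
subst p; exists v => //.
have ur1 : logn r u = 1 by lia.
have /= := ndiv_ratio u_gt0 v_gt0 r_pr eq_log; rewrite ur1 v_r => ratio.
(* Strictness comes from [r] dividing [u] but not [H']. *)
have u_lt : u < H'.
  rewrite ltn_neqAle (le_g u u_g) andbT; apply/eqP => uH'.
  by move: ur1; rewrite uH' br.
by have := leq_ndiv_consecutive cons (z := u); rewrite u_gt0 u_lt => /(_ isT); lia.
Qed.

(** * The minimum along a geodesic and the value of the capacity *)

Lemma min_ndiv_le g z : z \in g -> min_ndiv g <= ndiv z.
Proof.
rewrite /min_ndiv; elim: g (ndiv _) => //= w g IHg c; rewrite inE big_cons geq_min.
by case/orP=> [/eqP-> | /IHg->]; rewrite ?leqnn ?orbT.
Qed.

(** Being a geodesic makes [g] nonempty, so the value seeding the minimum is that of a genuine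
    vertex. *)
Lemma min_ndiv_ge H H' g c : geodesic H H' g ->
  all (fun z => c <= ndiv z) g -> c <= min_ndiv g.
Proof.
case: g => [|w g] [] //= _ _ _ _ /andP[c_w c_g].
rewrite /min_ndiv big_cons leq_min c_w /=.
by rewrite big_seq; elim/big_ind: _ => [//|a b ac bc|z /(allP c_g)//]; rewrite leq_min ac.
Qed.

Theorem theorem6p8 (H H' r k : nat) (D I : nat -> layer)
  (consHH' : consecutive_hc H H')
  (r_prime : prime r) (ar : logn r H = 1) (br : logn r H' = 0)
  (only_r : forall p, prime p -> p != r -> ~ (0 < logn p H /\ logn p H' = 0))
  (D_lists : lists [seq D i | i <- iota 1 k]
               (fun l => required_deletion H H' l && (l != (r, 1))))
  (D_stack : forall i h, 1 <= i -> i < h -> h <= k ->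
     (D i).1 = (D h).1 -> (D h).2 < (D i).2)
  (I_required : forall i, 1 <= i <= k -> required_insertion H H' (I i))
  (I_inj : forall i h, 1 <= i <= k -> 1 <= h <= k -> I i = I h -> i = h)
  (e_lt_j : forall i, 1 <= i <= k -> stage_e H r D I i < (I i).2) :
  ((* (a) *)
   (forall i l h, 1 <= i <= k -> stage_e H r D I i < l < (I i).2 ->
      i < h <= k -> I h <> ((I i).1, l)) ->
   (* (b) *)
   (forall i, 1 <= i <= k -> stage_y H r D I i <= H) ->
   (* (c) *)
   (forall i, 1 <= i <= k -> (I i).2 <= (D i).2) ->
   (forall T : seq layer,
      lists T (remaining_insertion H H' r k D I) ->
      insertion_stack_admissible T ->
      admissible_geodesic H H' (schedule H r k D I T)) /\
   beta_geo H H' = (1 / 2)%R)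
  /\
  (forall i, 1 <= i <= k -> (D i).1 < (I i).1 -> (I i).2 <= (D i).2).
Proof.
have [hcH hcH' ltHH' _] := consHH'.
have H_gt0 : 0 < H by case: hcH.
have leHH' := ltnW ltHH'.
split; last first.
  move=> i i_in lt_pq.
  have [p_pr _ lev_p] := stage_deletionP H_gt0 r_prime ar br D_lists i_in.
  have /andP[q_pr lev_q] := I_required i i_in.
  by have := logn_hc hcH' p_pr q_pr lt_pq; lia.
move=> _ le_yH le_jA.
have admissible T := @schedule_admissible _ _ _ _ _ _ H_gt0 r_prime ar br
  D_lists D_stack I_required e_lt_j T leHH' le_yH le_jA.
split; first by move=> T listT stackT; case: (admissible T listT stackT).
(* The capacity does not mention [T], so a concrete order is needed to have a witness. The bound
   [H'.+1] works since an inserted prime divides [H'] and its level is at most its exponent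
   there. *)
have [|T listT stackT] :=
  @exists_insertion_order (remaining_insertion H H' r k D I) H'.+1.
  case=> q j /andP[/andP[/= q_pr lev_q] _].
  have H'_gt0 : 0 < H' by apply: leq_trans leHH'.
  have := ltn_logl q H'_gt0; have : q %| H'.
    by rewrite -(expn1 q) pfactor_dvdn //; lia.
  by move/(dvdn_leq H'_gt0) => /=; lia.
have [adm_g high_g] := admissible T listT stackT.
set g := schedule _ _ _ _ _ _ in adm_g high_g.
rewrite /beta_geo; set M := \max_(c < _ | _) c.
(* The rational quotient is reduced to an equality in [nat], which in particular makes the divisor
   count of [H] even. *)
suff def_H : ndiv H = M * 2.
  have := ndiv_gt0 H; rewrite def_H GRing.natrM muln_gt0 => /andP[M_gt0 _].
  have M_ne0 : (M%:R != 0 :> rat)%R by rewrite Num.Theory.pnatr_eq0 -lt0n.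
  by field.
have geo_g := adm_g.1.
have H_in : H \in g by rewrite mem_head.
have le_c : ndiv H <= min_ndiv g * 2.
  (* The lower bound on the vertices is rounded up to an integer before passing to the minimum, so
     nothing is lost. *)
  have : (ndiv H).+1 %/ 2 <= min_ndiv g; last by lia.
  by apply: min_ndiv_ge geo_g _; apply: sub_all high_g => z; lia.
apply/eqP; rewrite eqn_leq; apply/andP; split.
  apply: leq_trans le_c _; rewrite leq_pmul2r //.
  (* The maximum ranges over values up to [ndiv H]; the vertex [H] puts the minimum of [g] in that
     range. *)
  have lt_c : min_ndiv g < (ndiv H).+1 by rewrite ltnS min_ndiv_le.
  apply: (leq_bigmax_cond (Ordinal lt_c)); apply/asboolP.
  by exists g.
suff : M <= (ndiv H) %/ 2 by rewrite leq_divRL.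
apply/bigmax_leqP => c /asboolP[g' adm_g' <-]; rewrite leq_divRL //.
have [z z_in low_z] := geodesic_low_vertex consHH' r_prime ar br adm_g'.
by have := min_ndiv_le z_in; lia.
Qed.
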